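(* Let $n, D, N$ be positive integers with $1\le n\le \min\{D,N-D\}$, let $Y_1,\dots,Y_n$ be a sample drawn without replacement from an urn with $N$ balls of which $D$ are labeled $1$ and $N-D$ are labeled $0$, and let $\overline Y_n=n^{-1}\sum_{i=1}^n Y_i$ (so that $n\overline Y_n$ has the Hypergeometric$(n,D,N)$ distribution). Put $\mu_N=D/N$, $\sigma_N^2=\mu_N(1-\mu_N)$, $f_n=\frac{n-1}{N-1}$, and $\psi(y)=2y^{-2}h(1+y)$ for $y>0$, where $h(y)=y(\log y-1)+1$. Then for all $\lambda>0$, $$P\left(\sqrt n(\overline Y_n-\mu_N)\ge\lambda\right)\le \exp\left(-\frac{2\lambda^2}{1-f_n}\,\psi\left(\frac{\lambda}{\sqrt n\,\sigma_N^2(1-f_n)}\right)\right)\le \exp\left(-\frac{2\lambda^2}{1-f_n}\,\psi\left(\frac{1}{\sigma_N^2(1-f_n)}\right)\right).$$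
   Context: The Hypergeometric$(n,D,N)$ distribution is given by $P\left(\sum_{i=1}^n Y_i=k\right)=\binom{D}{k}\binom{N-D}{n-k}/\binom{N}{n}$ for $\max\{0,D+n-N\}\le k\le\min\{n,D\}$. The factor $1-f_n$ is the finite-sampling correction factor.
   Formalization: The inequality between the two exponentials is claimed only for λ ≤ √n, since it fails for λ > √n (e.g. n = D = 1, N = 2, λ = 6); the probability is bounded by each of the two exponentials for all λ > 0. *)

(* Defs.v *)
From HB Require Import structures.
From mathcomp Require Import all_boot all_order all_algebra.
From mathcomp Require Import all_classical all_reals all_analysis.
Set Implicit Arguments.
Unset Strict Implicit.
Unset Printing Implicit Defensive.
Import Order.TTheory GRing.Theory Num.Theory.
Local Open Scope classical_set_scope.
Local Open Scope ring_scope.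

(* The urn consists of the balls 'I_N; [X i w] is the ball obtained at draw [i].
   Every ordered list of [n] distinct balls is equally likely, and there are
   [N ^_ n] such lists; for [n <= N] this forces lists with a repeated ball to
   have probability 0. *)
Definition drawn_without_replacement (R : realType) (d : measure_display)
    (T : measurableType d) (P : probability T R) (n N : nat)
    (X : 'I_n -> T -> 'I_N) : Prop :=
  (forall i k, measurable [set w | X i w = k]) /\
  (forall b : 'I_n -> 'I_N, injective b ->
     P [set w | forall i, X i w = b i] = ((N ^_ n)%:R^-1)%:E).

Definition draw_label (R : realType) (T : Type) (n N : nat)
    (label : 'I_N -> bool) (X : 'I_n -> T -> 'I_N) (i : 'I_n) (w : T) : R :=
  (label (X i w))%:R.

Definition sample_mean (R : realType) (T : Type) (n : nat)
    (Y : 'I_n -> T -> R) (w : T) : R :=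
  n%:R^-1 * \sum_(i < n) Y i w.

Definition urn_mean (R : realType) (D N : nat) : R := D%:R / N%:R.

Definition urn_variance (R : realType) (D N : nat) : R :=
  urn_mean R D N * (1 - urn_mean R D N).

Definition sampling_fraction (R : realType) (n N : nat) : R :=
  (n%:R - 1) / (N%:R - 1).

Definition bennett_h (R : realType) (y : R) : R := y * (ln y - 1) + 1.

(* Intended for [0 < y], where it is strictly decreasing: hence
   [bennett_psi (1 / a) <= bennett_psi (lambda / (Num.sqrt n%:R * a))] for [0 < a]
   exactly when [lambda <= Num.sqrt n%:R]. *)
Definition bennett_psi (R : realType) (y : R) : R :=
  2 * y ^- 2 * bennett_h (1 + y).

(* Main.v *)
Require Import Defs.
From HB Require Import structures.
From mathcomp Require Import all_boot all_order all_algebra.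
From mathcomp Require Import all_classical all_reals all_analysis.
From mathcomp Require Import ring lra zify.
Set Implicit Arguments.
Unset Strict Implicit.
Unset Printing Implicit Defensive.
Import Order.TTheory GRing.Theory Num.Theory.
Import numFieldNormedType.Exports.
Local Open Scope classical_set_scope.
Local Open Scope ring_scope.

(** Write M = N - D and let S be the number of labelled balls drawn, so that S
    has mean mu = nD/N and variance V = n sigma^2 (1 - f).  The theorem follows
    from Bennett's inequality with the exact variance,
      P (S >= mu + V y) <= exp (- V h (1 + y)),
    because 4 sigma^2 <= 1.

    The summands of S are dependent, so the usual product formula for the
    generating function is not available.  It is replaced by a tangent-line
    bound.  Let p(w) be the sum over k of C(D,k) C(M,n-k) w^k, which is the
    generating function of S up to the factor C(N,n), and let
    L(w) = w p'(w) / p(w) be the mean of S under the law tilted by w^S.  If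
      L(w) <= mu + V (w - 1)   for w >= 1,
    then mu ln w + V (w - 1 - ln w) - ln p(w) is nondecreasing on w >= 1, which
    is the Poisson-type bound [hyper_poly_le_expR] that gives Bennett's
    exponent at w = 1 + y.

    The tangent-line bound [tilted_mean_le] comes from the hypergeometric
    differential equation of p, which makes L solve the Riccati equation
      w (w - 1) L' = L (M - n + L) - w (D - L) (n - L).
    Wherever L lies strictly above the tangent line, this equation forces L to
    be steeper than the line ([above_tangent_steep]).  The excess of L over the
    line could then never come back to 0, whereas L <= n and the line is
    unbounded.

    On the probabilistic side, the hypothesis on the draws determines the law of
    the whole list of balls ([probability_draw]), and summing w^S over the lists
    of distinct balls gives n! p(w) ([hyper_poly_inj_sum]).

    The second bound follows from the first because psi is decreasing, as long
    as lambda <= sqrt n; for larger lambda the event is empty. *)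

(** * The hypergeometric generating function and its differential equation *)

Definition hyper_coef (D M n k : nat) : nat := ('C(D, k) * 'C(M, n - k))%N.

(** The generating function of the hypergeometric law, multiplied by
    'C(D + M, n) so that its coefficients are integers. *)
Definition hyper_poly (R : realType) (D M n : nat) : {poly R} :=
  \poly_(k < n.+1) (hyper_coef D M n k)%:R.

(** The Euler operator z d/dz; applied to a generating function it multiplies
    the weight of the value k by k, so its iterates give the moments of the
    tilted law. *)
Definition euler (R : realType) (p : {poly R}) : {poly R} := p^`() * 'X.

Lemma coef_euler (R : realType) (p : {poly R}) k :
  (euler p)`_k = k%:R * p`_k.
Proof.
rewrite /euler coefMX; case: k => [|k] /=; first by rewrite mul0r.
by rewrite coef_deriv mulr_natl.
Qed.

Lemma hyper_coef_step (D M n k : nat) : (n <= D)%N -> (n <= M)%N -> (k < n)%N ->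
  (k.+1 * (M - n + k.+1) * hyper_coef D M n k.+1 =
   (D - k) * (n - k) * hyper_coef D M n k)%N.
Proof.
move=> nD nM kn; rewrite /hyper_coef.
have := mul_bin_left D k; have := mul_bin_left M (n - k.+1).
have -> : (n - k.+1).+1 = (n - k)%N by lia.
have -> : (M - (n - k.+1) = M - n + k.+1)%N by lia.
move=> HM HD.
transitivity ((k.+1 * 'C(D, k.+1)) * ((M - n + k.+1) * 'C(M, n - k.+1)))%N.
  by ring.
by rewrite HD -HM; ring.
Qed.

Section ode.
Variables (R : realType) (D M n : nat).
Hypotheses (nD : (n <= D)%N) (nM : (n <= M)%N).
Let p := hyper_poly R D M n.

Lemma coef_hyper_poly k :
  p`_k = if (k <= n)%N then (hyper_coef D M n k)%:R else 0.
Proof. by rewrite coef_poly ltnS. Qed.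

(** The hypergeometric differential equation of [p]: it is [hyper_coef_step]
    read coefficient by coefficient. *)
Lemma hyper_poly_ode :
  (M%:R - n%:R)%:P * euler p + euler (euler p) =
  ((D%:R * n%:R)%:P * p - (D%:R + n%:R)%:P * euler p + euler (euler p)) * 'X.
Proof.
apply/polyP => k.
rewrite coefMX !(coefD, coefN, coefCM, coef_euler, coef_hyper_poly).
case: k => [|k] /=; first by rewrite !mul0r mulr0 addr0.
have [lkn|] := ltnP k n; last first.
  rewrite leq_eqVlt => /predU1P[<-|nk].
    by rewrite leqnn; ring.
  by rewrite leqNgt nk /=; ring.
rewrite (ltnW lkn).
have := congr1 (fun m : nat => m%:R : R) (hyper_coef_step nD nM lkn).
rewrite /= !natrM natrD !natrB //; [|lia|lia].
by move=> E; apply: (etrans (etrans _ E)); ring.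
Qed.

Lemma hyper_ode w :
  (euler (euler p)).[w] * (w - 1) = (M%:R - n%:R) * (euler p).[w]
    - w * (D%:R * n%:R * p.[w] - (D%:R + n%:R) * (euler p).[w]).
Proof.
have := hyper_poly_ode.
move: (euler (euler p)) (euler p) => e2 e1 /(congr1 (fun q => q.[w])).
by rewrite !hornerE => E; lra.
Qed.

Lemma hyper_poly_gt0 w : 0 < w -> 0 < p.[w].
Proof.
move=> w0; rewrite /p /hyper_poly horner_poly big_ord_recl /=.
rewrite expr0 mulr1 ltr_pwDl //.
  by rewrite ltr0n /hyper_coef bin0 mul1n subn0 bin_gt0.
by apply: sumr_ge0 => i _; rewrite mulr_ge0 // exprn_ge0 // ltW.
Qed.

(** The tilted law lives on {0, ..., n}, so its mean is at most [n]. *)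
Lemma euler_hyper_poly_le w : 0 < w -> (euler p).[w] <= n%:R * p.[w].
Proof.
move=> w0; rewrite -subr_ge0.
have -> : n%:R * p.[w] - (euler p).[w] = (n%:R%:P * p - euler p).[w].
  by rewrite !hornerE.
have -> : n%:R%:P * p - euler p =
   \poly_(k < n.+1) ((n - k)%:R * (hyper_coef D M n k)%:R).
  apply/polyP => k.
  rewrite !(coefD, coefN, coefCM, coef_euler, coef_hyper_poly) coef_poly ltnS.
  case: leqP => kn; last by ring.
  by rewrite natrB //; ring.
rewrite horner_poly; apply: sumr_ge0 => i _.
by rewrite !mulr_ge0 // exprn_ge0 // ltW.
Qed.

Lemma horner1_hyper_poly : p.[1] = 'C(D + M, n)%:R.
Proof.
rewrite /p /hyper_poly horner_poly -(binomial.Vandermonde D M n) natr_sum.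
by apply: eq_bigr => i _; rewrite expr1n mulr1.
Qed.

End ode.

(** * Monotonicity of Bennett's function *)

Lemma le_of_derive_ge0 (R : realType) (f f' : R -> R) (a b : R) : a <= b ->
  (forall x, x \in `[a, b] -> is_derive x 1 f (f' x)) ->
  (forall x, x \in `]a, b[ -> 0 <= f' x) -> f a <= f b.
Proof.
move=> ab df f'0.
have sub x : x \in `]a, b[ -> x \in `[a, b] by apply: subset_itv_oo_cc.
apply: (@ger0_derive1_le_cc _ f a b) => //.
- by move=> x /sub/df.
- move=> x xab; rewrite derive1E; have [_ ->] := df _ (sub _ xab).
  exact: f'0.
- by apply: derivable_within_continuous => x /df.
- by rewrite in_itv /= lexx ab.
- by rewrite in_itv /= lexx ab.
Qed.

Lemma ln_ge_1BV (R : realType) (x : R) : 0 < x -> 1 - x^-1 <= ln x.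
Proof.
move=> x0; have xV0 : 0 < x^-1 by rewrite invr_gt0.
have := @le_ln1Dx _ (x^-1 - 1).
have -> : 1 + (x^-1 - 1) = x^-1 by ring.
rewrite lnV ?posrE //.
by move=> H; have := H ltac:(lra); lra.
Qed.

Lemma is_derive_ln1D (R : realType) (y : R) : 0 <= y ->
  is_derive y 1 (fun z : R => ln (1 + z)) (1 + y)^-1.
Proof.
move=> y0; rewrite -[X in is_derive _ _ _ X]mulr1.
apply: (@is_derive1_comp _ (@ln R) (fun z => 1 + z)).
  by apply: is_derive1_ln; lra.
by apply: is_derive_eq; rewrite add0r mulr1.
Qed.

Lemma bennett_h_ge0 (R : realType) (y : R) : 0 <= y -> 0 <= bennett_h (1 + y).
Proof.
move=> y0; have := @ln_ge_1BV R (1 + y) ltac:(lra).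
rewrite /bennett_h -(ler_pM2l (_ : 0 < 1 + y)); last lra.
by rewrite mulrBr mulfV; lra.
Qed.

(** The right-hand side exceeds the left by a function that vanishes at 0 and
    has derivative ln (1 + y) - y / (1 + y), which is nonnegative.  The bound
    2 y / (2 + y) is the [1/1] Pade approximant of ln (1 + y) at 0. *)
Lemma ln1D_ge_pade (R : realType) (y : R) : 0 <= y ->
  2 * y <= (2 + y) * ln (1 + y).
Proof.
move=> y0; rewrite -subr_ge0.
pose f (z : R) := (2 + z) * ln (1 + z) - 2 * z.
suff : f 0 <= f y by rewrite /f !addr0 ln1; lra.
pose f' (z : R) := (2 + z) * (1 + z)^-1 + ln (1 + z) - 2.
apply: (@le_of_derive_ge0 _ f f') => // x; rewrite in_itv /= => /andP[x0 xy].
  have dl := is_derive_ln1D x0.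
  apply: is_derive_eq.
  by rewrite /f' /GRing.scale /=; ring.
have := @ln_ge_1BV R (1 + x) ltac:(lra).
rewrite /f'; have -> : (2 + x) * (1 + x)^-1 = 1 + (1 + x)^-1 by field; lra.
lra.
Qed.

(** The derivative of psi is 2 (2 x - (2 + x) ln (1 + x)) / x^3, which is
    nonpositive by [ln1D_ge_pade]. *)
Lemma bennett_psi_antitone (R : realType) (y z : R) : 0 < y -> y <= z ->
  bennett_psi z <= bennett_psi y.
Proof.
move=> y0 yz; rewrite -lerN2.
pose f' (x : R) := - (2 * (2 * x - (2 + x) * ln (1 + x)) / x ^+ 3).
apply: (@le_of_derive_ge0 _ (fun x => - bennett_psi x) f') => // x;
  rewrite in_itv /= => /andP[x0 xy].
  have xp : 0 < x by lra.
  have dl := is_derive_ln1D (ltW xp).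
  have xn : x ^+ 2 != 0 by rewrite expf_neq0 // gt_eqF.
  have dV : is_derive x 1 (fun t : R => t ^- 2) (- (x ^+ 2) ^- 2 *: (2 * x)).
    apply: is_deriveV => //.
    by apply: is_derive_eq; rewrite /GRing.scale /=; ring.
  rewrite /bennett_psi /bennett_h.
  apply: is_derive_eq.
  rewrite /f' /GRing.scale /=; field.
  by apply/andP; split; lra.
rewrite /f' oppr_ge0 pmulr_lle0 ?invr_gt0 ?exprn_gt0 //; last lra.
by have := @ln1D_ge_pade R x ltac:(lra); lra.
Qed.

(** * The tilted mean lies below its tangent line *)

Definition hyper_mean (R : realType) (D M n : nat) : R :=
  n%:R * (D%:R / (D + M)%:R).

Definition hyper_variance (R : realType) (D M n : nat) : R :=
  n%:R * (D%:R / (D + M)%:R) * (M%:R / (D + M)%:R)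
  * (((D + M)%:R - n%:R) / ((D + M)%:R - 1)).

(** In terms of the tilted moments m = s1 / s0 and q = s2 / s0 at w = 1 + x, the
    tilted variance q - m^2 equals w L'(w), and the differential equation reads
    x (q - m^2) = (D + M) (m - mu) - x (D - m) (n - m).  As soon as m lies above
    mu + V x, the first term on the right exceeds (D + M) V x, while
    (D - m) (n - m) has dropped by at least V x from its value (D + M - 1) V at
    x = 0, because D - mu >= 1 and m <= n.  Hence q - m^2 > V (1 + x), that is,
    L is steeper than its tangent line.  The conclusion has (mu + V x) m in
    place of m^2, which is larger: this is the form in which the derivative of
    (L - mu - V x) p brings it. *)
Lemma above_tangent_steep (R : realFieldType) (D M n mu V x s0 s1 s2 : R) :
  0 < x -> 0 < V -> 0 < s0 -> 0 <= mu -> 0 < D + M -> 1 <= D - mu ->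
  mu * (D + M) = n * D -> V * (D + M - 1) = (D - mu) * (n - mu) ->
  s2 * x = (M - n) * s1 - (1 + x) * (D * n * s0 - (D + n) * s1) ->
  s1 <= n * s0 -> (mu + V * x) * s0 < s1 ->
  (mu + V * x) * s1 + V * (1 + x) * s0 < s2.
Proof.
move=> x0 V0 s00 mu0 N0 Dmu emu eV ode s1n us1.
have sn0 : s0 != 0 by rewrite gt_eqF.
pose m := s1 / s0; pose q := s2 / s0.
have es1 : s1 = m * s0 by rewrite /m divfK.
have es2 : s2 = q * s0 by rewrite /q divfK.
rewrite es1 es2 in ode s1n us1 *.
have {us1} um : mu + V * x < m by move: us1; rewrite ltr_pM2r.
have {s1n} mn : m <= n by move: s1n; rewrite ler_pM2r.
have {}ode : q * x = (M - n) * m - (1 + x) * (D * n - (D + n) * m).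
  by apply: (mulIf sn0); rewrite mulrAC ode; ring.
rewrite mulrA -mulrDl ltr_pM2r // -(ltr_pM2r x0).
have Vx : 0 < V * x by rewrite mulr_gt0.
pose y := m - mu.
have yx : V * x < y by rewrite /y; lra.
(* The excess of m over the tangent line, multiplied by D + M, and the decrease
   of (D - m) (n - m) below its value at m = mu, net of V x. *)
have gain : 0 < (D + M) * (y - V * x) by rewrite mulr_gt0 //; lra.
have curv : 0 <= x * (y * (D - mu + (n - m) - 1) + (y - V * x)).
  apply: mulr_ge0; first exact: ltW.
  by apply: addr_ge0; [apply: mulr_ge0|]; lra.
have above : (mu + V * x) * m <= m * m by rewrite ler_wpM2r; lra.
have : ((mu + V * x) * m) * x <= m * m * x by rewrite ler_wpM2r // ltW.
suff : (m * m + V * (1 + x)) * x < q * x by lra.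
suff -> : q * x = (m * m + V * (1 + x)) * x + ((D + M) * (y - V * x)
     + x * (y * (D - mu + (n - m) - 1) + (y - V * x))) by lra.
rewrite ode.
have -> : (M - n) * m - (1 + x) * (D * n - (D + n) * m) =
  (D + M) * m - n * D - x * ((D - m) * (n - m)) + x * (m * m) by ring.
have -> : (D - m) * (n - m) =
  (D - mu) * (n - mu) - y * (D + n - 2 * mu) + y * y.
  by rewrite /y; ring.
by rewrite -eV -emu /y; ring.
Qed.

Section tilted.
Variables (R : realType) (D M n : nat).
Hypotheses (n0 : (0 < n)%N) (nD : (n <= D)%N) (nM : (n <= M)%N).
Let p := hyper_poly R D M n.
Let mu := hyper_mean R D M n.
Let V := hyper_variance R D M n.

Let sizes : [/\ (1 : R) <= n%:R, (n%:R : R) <= D%:R & (n%:R : R) <= M%:R].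
Proof. by rewrite ler1n !ler_nat. Qed.

Lemma hyper_variance_gt0 : 0 < V.
Proof.
have [n0' nD' nM'] := sizes.
by rewrite /V /hyper_variance natrD !(mulr_gt0, invr_gt0) //; lra.
Qed.

Lemma hyper_mean_total : mu * (D%:R + M%:R) = n%:R * D%:R.
Proof.
have [n0' nD' nM'] := sizes.
by rewrite /mu /hyper_mean natrD -mulrA divfK //; lra.
Qed.

(** This is what makes V the slope of L at w = 1: dividing the Riccati equation
    by w - 1 and letting w tend to 1 gives
    L'(1) = (D + M) L'(1) - (D - mu) (n - mu). *)
Lemma hyper_variance_total :
  V * (D%:R + M%:R - 1) = (D%:R - mu) * (n%:R - mu).
Proof.
have [n0' nD' nM'] := sizes.
rewrite /V /mu /hyper_variance /hyper_mean natrD; field.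
by apply/andP; split; lra.
Qed.

(** A single draw is a Bernoulli variable, whose tilted mean is the explicit
    homography D w / (M + D w).  This case is separate because D - mu >= 1,
    which [above_tangent_steep] requires, fails for n = D = 1. *)
Lemma tilted_mean_le_draw1 w : n = 1%N -> 0 <= w ->
  (euler p).[w] <= (mu + V * (w - 1)) * p.[w].
Proof.
have [n0' nD' nM'] := sizes.
move=> n1 w0.
have pE : p.[w] = M%:R + D%:R * w.
  rewrite /p n1 horner_poly big_ord_recl big_ord1 /hyper_coef /= expr0 expr1.
  by rewrite /bump /= subn0 subnn !bin0 !bin1 mul1n muln1 mulr1.
have eE : (euler p).[w] = D%:R * w.
  rewrite /euler /p n1 hornerMX; congr (_ * _).
  rewrite /hyper_poly poly_def big_ord_recl big_ord1 /hyper_coef /=.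
  rewrite derivD !derivZ /= expr0 expr1 derivX derivC scaler0 add0r.
  by rewrite hornerZ hornerC /bump /= subnn bin0 bin1 muln1 mulr1.
rewrite pE eE -subr_ge0 /mu /V /hyper_mean /hyper_variance n1 natrD.
have /ltW D0 : 0 < D%:R :> R by lra.
have /ltW M0 : 0 < M%:R :> R by lra.
set X := (X in 0 <= X).
suff -> : X = D%:R ^+ 2 * M%:R * (w - 1) ^+ 2 / (D%:R + M%:R) ^+ 2.
  apply: divr_ge0; rewrite ?sqr_ge0 //.
  by rewrite mulr_ge0 ?sqr_ge0 // mulr_ge0 ?sqr_ge0.
rewrite /X; field.
by apply/andP; split; lra.
Qed.

(** The excess u = (L - line) p is a polynomial that is nonpositive at 1 and
    from the point W on, where the line reaches n.  If it were positive
    somewhere, it would have a positive maximum in between, where u' = 0; but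
    [above_tangent_steep] makes u' positive there. *)
Lemma tilted_mean_le w : 1 <= w ->
  (euler p).[w] <= (mu + V * (w - 1)) * p.[w].
Proof.
have [n0' nD' nM'] := sizes.
move=> w1; have w0 : 0 < w by lra.
have [n1|n2] := eqVneq n 1%N; first by apply: tilted_mean_le_draw1 => //; lra.
have V0 := hyper_variance_gt0.
have emu := hyper_mean_total.
have {}n2 : 2 <= n%:R :> R by rewrite ler_nat; lia.
have N0 : 0 < D%:R + M%:R :> R by lra.
have mu0 : 0 <= mu by rewrite -(pmulr_lge0 _ N0) emu mulr_ge0.
(* D - mu = D (D + M - n) / (D + M), where D >= 2 and D + M >= 2 n. *)
have Dmu : 1 <= D%:R - mu.
  rewrite -(ler_pM2r N0) mulrBl emu.
  have : 0 <= (D%:R - 2) * (M%:R - n%:R + D%:R) :> R by rewrite mulr_ge0; lra.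
  have : 0 <= D%:R * (D%:R - 2) :> R by rewrite mulr_ge0; lra.
  nra.
pose W := 1 + (n%:R - mu) / V.
have pW v : 1 <= v -> W <= v -> (euler p).[v] <= (mu + V * (v - 1)) * p.[v].
  move=> v1 Wv; apply: (le_trans (euler_hyper_poly_le _ _ _ _)); first lra.
  rewrite ler_pM2r; last by apply: hyper_poly_gt0 => //; lra.
  have : (n%:R - mu) / V <= v - 1 by move: Wv; rewrite /W; lra.
  by rewrite ler_pdivrMr //; lra.
have [Ww|wW] := leP W w; first exact: pW.
pose u := euler p - ((mu - V)%:P + V *: 'X) * p.
have uE v : u.[v] = (euler p).[v] - (mu + V * (v - 1)) * p.[v].
  rewrite /u; move: (euler p) => e; rewrite !hornerE; ring.
have [c] := @EVT_max R (horner u) 1 W ltac:(lra)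
  (continuous_subspaceT (@continuous_horner R u)).
rewrite in_itv /= => /andP[c1 cW] cmax.
have uw : u.[w] <= u.[c] by apply: cmax; rewrite in_itv /=; lra.
rewrite -subr_le0 -uE; apply: (le_trans uw); rewrite leNgt; apply/negP => uc.
have c1' : 1 < c.
  rewrite lt_neqAle c1 andbT; apply/eqP => ce; move: uc; rewrite -ce uE.
  have := @hyper_ode R D M n nD nM 1.
  rewrite !subrr !mulr0 addr0 -/p !mul1r => E.
  have {}E : (D%:R + M%:R) * (euler p).[1] = n%:R * D%:R * p.[1] by lra.
  rewrite -(pmulr_rgt0 _ N0) mulrBr E mulrA (mulrC _ mu) emu; lra.
have cW' : c < W.
  rewrite lt_neqAle cW andbT; apply/eqP => ce; move: uc; rewrite ce uE.
  have := pW W ltac:(lra) ltac:(lra); lra.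
have [_ der0] : is_derive c 1 (horner u) 0.
  apply: (@derive1_at_max _ _ 1 W) => //; first lra.
  - by rewrite in_itv /= c1'.
  - by move=> t /subset_itv_oo_cc /cmax.
have [_] := is_derive_poly u c; rewrite der0 => u'c.
have c0 : 0 < c by lra.
have ode := @hyper_ode R D M n nD nM c.
have euler_c : (euler p).[c] = c * p^`().[c] by rewrite /euler hornerMX mulrC.
(* The vanishing of c u'(c), spelled out with the Euler operator. *)
have crit : (euler (euler p)).[c] =
    (mu + V * (c - 1)) * (euler p).[c] + V * c * p.[c].
  have : 0 = c * u^`().[c] by rewrite -u'c mulr0.
  rewrite {1}/euler hornerMX /u euler_c; move: (euler p) => e.
  rewrite derivB derivM derivD derivC derivZ derivX.
  rewrite !(hornerM, hornerD, hornerN, hornerC, hornerX, hornerZ).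
  by lra.
have := @above_tangent_steep R D%:R M%:R n%:R mu V (c - 1) p.[c] (euler p).[c]
  (euler (euler p)).[c].
have -> : 1 + (c - 1) = c by ring.
rewrite crit ltxx => steep; suff : false by [].
apply: steep => //; try lra.
- exact: hyper_poly_gt0.
- exact: hyper_variance_total.
- by rewrite -crit.
- exact: euler_hyper_poly_le.
- by move: uc; rewrite uE subr_gt0.
Qed.
End tilted.

(** * Bennett's bound for the generating function *)

(** The right-hand side is p(1) times the value at w of the generating function
    of a centred Poisson variable of variance V, shifted by mu; the logarithmic
    derivatives compare by [tilted_mean_le]. *)
Lemma hyper_poly_le_expR (R : realType) (D M n : nat) (w : R) :
  (0 < n)%N -> (n <= D)%N -> (n <= M)%N -> 1 <= w ->
  (hyper_poly R D M n).[w] <= (hyper_poly R D M n).[1]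
    * expR (hyper_mean R D M n * ln w
            + hyper_variance R D M n * (w - 1 - ln w)).
Proof.
move=> n0 nD nM w1.
set p := hyper_poly R D M n; set mu := hyper_mean R D M n.
set V := hyper_variance R D M n.
have p0 x : 1 <= x -> 0 < p.[x] by move=> x1; apply: hyper_poly_gt0 => //; lra.
pose F (x : R) := mu * ln x + V * (x - 1 - ln x) - ln p.[x].
pose F' x := mu * x^-1 + V * (1 - x^-1) - p.[x]^-1 * p^`().[x].
have F1 : F 1 <= F w.
  apply: (@le_of_derive_ge0 _ F F') => // x; rewrite in_itv /= => /andP[x1 _].
    have dl := @is_derive1_ln _ x ltac:(lra).
    have dp := is_derive_poly p x.
    have dlp : is_derive x 1 (fun y => ln p.[y]) (p.[x]^-1 * p^`().[x]).
      apply: (@is_derive1_comp _ (@ln R) (horner p)).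
      exact/is_derive1_ln/p0.
    apply: is_derive_eq.
    by rewrite /F' /GRing.scale /=; ring.
  have px := p0 x (ltW x1).
  have := tilted_mean_le n0 nD nM (ltW x1).
  rewrite /euler hornerMX -/p -/mu -/V.
  have x0 : 0 < x by lra.
  rewrite -(pmulr_rge0 _ px) -(pmulr_rge0 _ x0) /F' => H.
  have -> : x * (p.[x] * (mu * x^-1 + V * (1 - x^-1) - p.[x]^-1 * p^`().[x]))
    = (mu + V * (x - 1)) * p.[x] - p^`().[x] * x.
    by field; apply/andP; split; lra.
  by rewrite subr_ge0.
move: F1; rewrite /F ln1 subrr subr0 !mulr0 !add0r => F1.
have : ln p.[w] <= ln p.[1] + (mu * ln w + V * (w - 1 - ln w)) by lra.
by rewrite -ler_expR expRD !lnK ?posrE ?p0.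
Qed.

(** The choice w = 1 + y minimises w^-(mu + V y) w^mu exp (V (w - 1 - ln w))
    over w, and the minimum is Bennett's exponent. *)
Lemma hyper_chernoff (R : realType) (D M n : nat) (y : R) :
  (0 < n)%N -> (n <= D)%N -> (n <= M)%N -> 0 <= y ->
  (hyper_poly R D M n).[1 + y]
    * expR (- (hyper_mean R D M n + hyper_variance R D M n * y) * ln (1 + y))
  <= (hyper_poly R D M n).[1]
    * expR (- (hyper_variance R D M n * bennett_h (1 + y))).
Proof.
move=> n0 nD nM y0.
have le_pw :=
  @hyper_poly_le_expR R D M n (1 + y) n0 nD nM ltac:(lra).
apply: (le_trans (ler_wpM2r (expR_ge0 _) le_pw)).
rewrite -mulrA -expRD ler_wpM2l ?ler_expR //.
  by rewrite ltW // hyper_poly_gt0.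
by rewrite /bennett_h; lra.
Qed.

(** * The law of the draws *)

Lemma coef_binomial (R : comNzRingType) (w : R) (D k : nat) :
  ((w *: 'X + 1) ^+ D)`_k = w ^+ k *+ 'C(D, k).
Proof.
have -> : (w *: 'X + 1) ^+ D = \poly_(i < D.+1) (w ^+ i *+ 'C(D, i)).
  rewrite exprD1n poly_def; apply: eq_bigr => i _.
  by rewrite exprZn -scalerMnl.
by rewrite coef_poly; case: ltnP => // Dk; rewrite bin_small.
Qed.

(** Both sides are the coefficient of X^n in the product of the factors
    1 + w^(label x) X, which is (1 + w X)^D (1 + X)^M. *)
Lemma hyper_poly_subset_sum (R : realType) (T : finType) (label : pred T)
    (n : nat) (w : R) :
  (hyper_poly R #|label| #|predC label| n).[w] =
  \sum_(A : {set T} | #|A| == n) \prod_(x in A) (w ^+ label x).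
Proof.
set D := #|label|; set M := #|predC label|.
have gen : ((w *: 'X + 1) ^+ D * (1 *: 'X + 1) ^+ M : {poly R}) =
    \sum_(A : {set T}) (\prod_(x in A) w ^+ label x) *: 'X^#|A|.
  transitivity (\prod_(x : T) ((w ^+ label x) *: 'X + 1 : {poly R})).
    rewrite (bigID label) /=; congr (_ * _).
      by rewrite -prodr_const; apply: eq_bigr => x; rewrite unfold_in => ->.
    by rewrite -prodr_const; apply: eq_big => // x /negbTE ->.
  rewrite bigA_distr; apply: eq_bigr => A _.
  by rewrite -big_mkcond /= scaler_prod prodr_const.
have := congr1 (fun q : {poly R} => q`_n) gen; rewrite /= coefM coef_sum.
rewrite horner_poly => E; transitivity (\sum_(k < n.+1)
    ((w *: 'X + 1) ^+ D)`_k * ((1 *: 'X + 1) ^+ M : {poly R})`_(n - k)).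
  apply: eq_bigr => k _.
  rewrite !coef_binomial expr1n /hyper_coef natrM.
  by rewrite -(mulr_natr (w ^+ k)); ring.
rewrite E [RHS]big_mkcond /=; apply: eq_bigr => A _.
by rewrite coefZ coefXn eq_sym; case: eqP; rewrite ?mulr1 ?mulr0.
Qed.

Lemma card_inj_onto (T : finType) (n : nat) (A : {set T}) : #|A| = n ->
  #|[pred b : {ffun 'I_n -> T} | injectiveb b & [set b i | i : 'I_n] == A]|
  = n`!.
Proof.
move=> An; have := card_inj_ffuns_on 'I_n (mem A).
rewrite card_ord (_ : #|mem A| = n) // ffactnn => <-.
apply: eq_card => b; rewrite !inE andbC.
have [/injectiveP binj|] := boolP (injectiveb b); last by rewrite !andbF.
rewrite !andbT eqEcard card_imset // card_ord An leqnn andbT.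
apply/fintype.subsetP/forallP => [sub i|on x /imsetP[i _ ->]]; last exact: on.
exact/sub/imset_f.
Qed.

(** A list of n distinct balls is one of the n! orderings of its image. *)
Lemma hyper_poly_inj_sum (R : realType) (T : finType) (label : pred T)
    (n : nat) (w : R) :
  \sum_(b : {ffun 'I_n -> T} | injectiveb b) w ^+ (\sum_i label (b i)) =
  n`!%:R * (hyper_poly R #|label| #|predC label| n).[w].
Proof.
rewrite hyper_poly_subset_sum mulr_sumr.
rewrite (partition_big (fun b : {ffun 'I_n -> T} => [set b i | i : 'I_n])
  (fun A => #|A| == n)) /=; last first.
  by move=> b /injectiveP binj; rewrite card_imset // card_ord.
apply: eq_bigr => A /eqP An.
rewrite -(card_inj_onto An) -sumr_const mulr_suml; apply: eq_bigr => b.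
rewrite mul1r => /andP[/injectiveP binj /eqP <-].
by rewrite expr_sum big_imset //= => i j _ _; exact: binj.
Qed.

Section urn.
Variables (R : realType) (d : measure_display) (T : measurableType d).
Variables (P : probability T R) (n N : nat) (X : 'I_n -> T -> 'I_N).
Hypotheses (nN : (n <= N)%N) (HX : drawn_without_replacement P X).

(** The lists of distinct balls already carry total mass 1, so every list with a
    repetition has probability 0. *)
Lemma probability_draw (Q : pred {ffun 'I_n -> 'I_N}) :
  P [set w | Q [ffun i => X i w]] =
  (\sum_(b : {ffun 'I_n -> 'I_N} | injectiveb b && Q b) (N ^_ n)%:R^-1)%:E.
Proof.
have [mX pX] := HX.
pose E (b : {ffun 'I_n -> 'I_N}) := [set w | forall i, X i w = b i].
have mE b : measurable (E b).
  have -> : E b = \bigcap_(i in [set: 'I_n]) [set w | X i w = b i].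
    by apply/seteqP; split=> [w H i _|w H i]; exact: H.
  by apply: fin_bigcap_measurable => //; exact: finite_finset.
have split_draw (Q' : pred {ffun 'I_n -> 'I_N}) :
    P [set w | Q' [ffun i => X i w]] = (\sum_(b | Q' b) P (E b))%E.
  have -> : [set w | Q' [ffun i => X i w]] = \bigcup_(b in [set` Q']) E b.
    apply/seteqP; split=> [w Qw|w [b Qb bw]] /=.
      by exists [ffun i => X i w] => // i; rewrite ffunE.
    by have -> : [ffun i => X i w] = b; [apply/ffunP => i; rewrite ffunE|].
  rewrite measure_fin_bigcup //; last first.
    by move=> b c _ _ [w [/= bw cw]]; apply/ffunP => i; rewrite -bw cw.
  by symmetry; apply: bigfs => [|b _]; rewrite ?index_enum_uniq ?mem_index_enum.
have pE (b : {ffun 'I_n -> 'I_N}) :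
    injectiveb b -> P (E b) = ((N ^_ n)%:R^-1)%:E.
  by move=> /injectiveP binj; exact: pX.
have sum_inj : (\sum_(b : {ffun 'I_n -> 'I_N} | injectiveb b) P (E b))%E = 1%E.
  rewrite (eq_bigr _ pE) sumEFin; congr (_%:E).
  rewrite sumr_const -[X in _ *+ X]cardsE card_inj_ffuns !card_ord.
  by rewrite -[LHS]mulr_natr mulVf // pnatr_eq0 -lt0n ffact_gt0.
have : (\sum_(b : {ffun 'I_n -> 'I_N} | ~~ injectiveb b) P (E b))%E = 0%E.
  have := split_draw xpredT.
  rewrite (bigID (fun b : {ffun 'I_n -> 'I_N} => injectiveb b)) /= sum_inj.
  rewrite (_ : [set _ | _] = setT) ?probability_setT; last exact/seteqP.
  have : (0 <= \sum_(b : {ffun 'I_n -> 'I_N} | ~~ injectiveb b) P (E b))%E.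
    by apply: sume_ge0 => b _; exact: measure_ge0.
  case: (\sum_(_ | _) _)%E => //= r _ [] H; congr (_%:E); lra.
move/eqP; rewrite seq_psume_eq0 => [/allP noninj0|b _]; last exact: measure_ge0.
rewrite split_draw (bigID (fun b : {ffun 'I_n -> 'I_N} => injectiveb b)) /=.
rewrite [X in (_ + X)%E]big1 ?adde0.
  rewrite -sumEFin; under eq_bigl do rewrite andbC.
  by apply: eq_bigr => b /andP[/pE].
move=> b /andP[_ ninj]; have := noninj0 b (mem_index_enum b).
by rewrite ninj => /eqP.
Qed.

(** Markov's inequality for w^S, with S the number of labelled balls drawn. *)
Lemma tail_le_markov (label : pred 'I_N) (w c : R) : 1 <= w ->
  (P [set x | (c <= \sum_(i < n) (label (X i x))%:R)%R] <=
   ((hyper_poly R #|label| #|predC label| n).[w] * expR (- c * ln w)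
    / 'C(N, n)%:R)%:E)%E.
Proof.
move=> w1; have w0 : 0 < w by lra.
pose S (b : {ffun 'I_n -> 'I_N}) := (\sum_i label (b i))%N.
have SX x : (S [ffun i => X i x])%:R = \sum_(i < n) (label (X i x))%:R :> R.
  by rewrite natr_sum; apply: eq_bigr => i _; rewrite ffunE.
have -> : [set x | c <= \sum_(i < n) (label (X i x))%:R :> R] =
    [set x | c <= (S [ffun i => X i x])%:R].
  by apply/seteqP; split => x /=; rewrite SX.
rewrite (probability_draw (fun b => c <= (S b)%:R)) lee_fin.
have Nn0 : 0 < (N ^_ n)%:R :> R by rewrite ltr0n ffact_gt0.
have -> : (hyper_poly R #|label| #|predC label| n).[w] * expR (- c * ln w)
    / 'C(N, n)%:R = \sum_(b : {ffun 'I_n -> 'I_N} | injectiveb b)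
       (w ^+ S b * expR (- c * ln w) * (N ^_ n)%:R^-1).
  rewrite -!mulr_suml hyper_poly_inj_sum -bin_ffact natrM; field.
  by rewrite !pnatr_eq0 -!lt0n fact_gt0 bin_gt0 nN.
rewrite big_mkcondr /=; apply: ler_sum => b _.
have pos : 0 <= w ^+ S b * expR (- c * ln w).
  by rewrite mulr_ge0 ?expR_ge0 // exprn_ge0 // ltW.
case: ifP => [cS|_]; last by rewrite mulr_ge0 // invr_ge0 ltW.
rewrite ler_peMl ?invr_ge0 ?(ltW Nn0) //.
rewrite -{1}(lnK w0) -expRM_natl -expRD -[X in X <= _]expR0 ler_expR.
have : 0 <= ((S b)%:R - c) * ln w by rewrite mulr_ge0 ?ln_ge0 // subr_ge0.
by lra.
Qed.
End urn.

(** * Tail bounds *)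

(** Markov's inequality at w = 1 + y, combined with [hyper_chernoff]; the factor
    p(1) there cancels the normalisation 'C(N, n). *)
Lemma bennett_without_replacement (R : realType) (d : measure_display)
    (T : measurableType d) (P : probability T R) (n N : nat)
    (X : 'I_n -> T -> 'I_N) (label : pred 'I_N) (y : R) :
  let D := #|label| in let M := #|predC label| in
  (0 < n)%N -> (n <= D)%N -> (n <= M)%N ->
  drawn_without_replacement P X -> 0 <= y ->
  (P [set x | (hyper_mean R D M n + hyper_variance R D M n * y
               <= \sum_(i < n) (label (X i x))%:R)%R] <=
   (expR (- (hyper_variance R D M n * bennett_h (1 + y))))%:E)%E.
Proof.
move=> D M n0 nD nM HX y0.
have DM : (D + M = N)%N by rewrite /D /M cardC card_ord.
have nN : (n <= N)%N by lia.
apply: (le_trans (tail_le_markov nN HX label _ (_ : 1 <= 1 + y))); first lra.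
rewrite lee_fin ler_pdivrMr ?ltr0n ?bin_gt0 //.
have := hyper_chernoff n0 nD nM y0.
by rewrite horner1_hyper_poly DM mulrC (mulrC _ 'C(N, n)%:R).
Qed.

Theorem corollary2 (R : realType) (d : measure_display) (T : measurableType d)
    (P : probability T R) (n D N : nat)
    (n_gt0 : (0 < n)%N) (D_gt0 : (0 < D)%N) (N_gt0 : (0 < N)%N)
    (n_le : (n <= minn D (N - D))%N)
    (label : 'I_N -> bool) (card_label : #|[set k | label k]%SET| = D)
    (X : 'I_n -> T -> 'I_N) (HX : drawn_without_replacement P X)
    (lambda : R) (lambda_gt0 : 0 < lambda) :
  let Y := draw_label R label X in
  let mu := urn_mean R D N in
  let sigma2 := urn_variance R D N in
  let f := sampling_fraction R n N in
  let tail := P [set w |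
    lambda <= Num.sqrt n%:R * (sample_mean Y w - mu)] in
  let bound1 := expR (- (2 * lambda ^+ 2 / (1 - f)
    * bennett_psi (lambda / (Num.sqrt n%:R * sigma2 * (1 - f))))) in
  let bound2 := expR (- (2 * lambda ^+ 2 / (1 - f)
    * bennett_psi (1 / (sigma2 * (1 - f))))) in
  [/\ (tail <= bound1%:E)%E,
      lambda <= Num.sqrt n%:R -> bound1 <= bound2
    & (tail <= bound2%:E)%E].
Proof.
move=> Y mu sigma2 f tail bound1 bound2.
have [nD nND] : (n <= D)%N /\ (n <= N - D)%N by lia.
have cardD : #|label| = D by rewrite -card_label cardsE.
have cardM : #|predC label| = (N - D)%N.
  by apply: (@addnI D); rewrite -{1}cardD cardC card_ord; lia.
have DN : (D + (N - D) = N)%N by lia.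
have nR : 1 <= n%:R :> R by rewrite ler1n.
have NR : 2 * n%:R <= N%:R :> R by rewrite -natrM ler_nat; lia.
have DR : n%:R <= D%:R :> R by rewrite ler_nat.
have DNR : D%:R + n%:R <= N%:R :> R by rewrite -natrD ler_nat; lia.
have NDR : (N - D)%:R = N%:R - D%:R :> R by rewrite natrB //; lia.
set s := Num.sqrt n%:R.
have s0 : 0 < s by rewrite sqrtr_gt0; lra.
have ss : s * s = n%:R by rewrite -expr2 sqr_sqrtr; lra.
have mu0 : 0 < mu by apply: divr_gt0; lra.
have mu1 : mu < 1 by rewrite /mu /urn_mean ltr_pdivrMr; lra.
have sig0 : 0 < sigma2 by apply: mulr_gt0; rewrite ?subr_gt0.
have sig4 : 4 * sigma2 <= 1.
  rewrite -subr_ge0 (_ : _ - _ = (1 - 2 * mu) ^+ 2) ?sqr_ge0 //.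
  by rewrite /sigma2 /urn_variance -/mu; ring.
have f1 : 0 < 1 - f by rewrite subr_gt0 /f /sampling_fraction ltr_pdivrMr; lra.
have meanE : hyper_mean R D (N - D) n = n%:R * mu by rewrite /hyper_mean DN.
have varE : hyper_variance R D (N - D) n = n%:R * sigma2 * (1 - f).
  rewrite /hyper_variance DN NDR /sigma2 /urn_variance /urn_mean.
  by rewrite /f /sampling_fraction; field; rewrite !gt_eqF //; lra.
set y := lambda / (s * sigma2 * (1 - f)) in bound1 *.
have den0 : 0 < s * sigma2 * (1 - f) by rewrite mulr_gt0 // mulr_gt0.
have y0 : 0 < y by exact: divr_gt0.
have lamE : lambda = s * sigma2 * (1 - f) * y.
  by rewrite /y mulrCA mulfV ?mulr1 // gt_eqF.
have tailE : tail = P [set x | n%:R * mu + n%:R * sigma2 * (1 - f) * y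
    <= \sum_(i < n) (label (X i x))%:R].
  rewrite /tail; congr (P _); apply/seteqP.
  suff eqv w : (lambda <= s * (sample_mean Y w - mu)) =
    (n%:R * mu + n%:R * sigma2 * (1 - f) * y
     <= \sum_(i < n) (label (X i w))%:R).
    by split=> w /=; rewrite eqv.
  rewrite /sample_mean /Y /draw_label; set S := \sum_(i < n) _.
  have -> : n%:R * sigma2 * (1 - f) * y = s * lambda by rewrite lamE -ss; ring.
  rewrite -(ler_pM2l s0) mulrA ss mulrBr mulrA mulfV ?pnatr_eq0 -?lt0n // mul1r.
  by rewrite lerBrDl.
have le1 : (tail <= bound1%:E)%E.
  rewrite tailE -meanE -varE.
  have := @bennett_without_replacement R d T P n N X label y.
  rewrite cardD cardM => /(_ n_gt0 nD nND HX (ltW y0)) /le_trans; apply.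
  rewrite lee_fin ler_expR lerN2 varE.
  have h0 := bennett_h_ge0 (ltW y0).
  (* The required exponent is 4 sigma^2 times Bennett's, and 4 sigma^2 <= 1. *)
  have -> : 2 * lambda ^+ 2 / (1 - f) * bennett_psi y =
      4 * sigma2 * (n%:R * sigma2 * (1 - f) * bennett_h (1 + y)).
    rewrite lamE /bennett_psi -ss; field; rewrite !gt_eqF //; lra.
  rewrite ler_piMl // mulr_ge0 // -varE ltW //.
  exact: hyper_variance_gt0.
have le12 : lambda <= s -> bound1 <= bound2.
  move=> lams; rewrite ler_expR lerN2 ler_wpM2l //.
    by rewrite divr_ge0 ?mulr_ge0 ?sqr_ge0 // ltW.
  apply: bennett_psi_antitone => //.
  rewrite /y ler_pdivrMr //.
  have -> : 1 / (sigma2 * (1 - f)) * (s * sigma2 * (1 - f)) = s.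
    field; rewrite !gt_eqF //; lra.
  by [].
split=> //.
have [lams|slam] := leP lambda s.
  by apply: (le_trans le1); rewrite lee_fin le12.
(* Beyond sqrt n the event is empty, since the sample mean is at most 1. *)
suff -> : tail = 0%E by rewrite lee_fin expR_ge0.
rewrite /tail (_ : [set w | _] = set0) ?measure0 //.
apply/seteqP; split=> // w /=; apply/negP; rewrite -ltNge.
apply: (le_lt_trans _ slam); rewrite -[X in _ <= X]mulr1 ler_pM2l //.
have mean1 : sample_mean Y w <= 1.
  rewrite /sample_mean ler_pdivrMl; last lra.
  rewrite mulr1 -[n in X in _ <= X]card_ord -sumr_const.
  by apply: ler_sum => i _; rewrite /Y /draw_label; case: (label _).
lra.
Qed.
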